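(* If $A=(A_n)_{n=0}^\infty$ is an Appell sequence and $\lambda$ is an integer partition, then \[ \varphi_A(s_\lambda) = \frac{A_\lambda}{H(\lambda)} = \frac{F_\lambda A_\lambda}{\lvert \lambda \rvert!}. \]
   Context: An Appell sequence is a sequence of polynomials $(A_n)_{n\ge0}$ with $A_0=1$ and $A_n'=nA_{n-1}$ for $n\ge1$. For a partition $\lambda=(\lambda_1\ge\dots\ge\lambda_r>0)$ of length $r$, let $(n_1,\dots,n_r)=(\lambda_r,\lambda_{r-1}+1,\dots,\lambda_1+r-1)$ and define the Wronskian Appell polynomial $A_\lambda=\operatorname{Wr}[A_{n_1},\dots,A_{n_r}]/\Delta(n_1,\dots,n_r)$, where $\operatorname{Wr}$ is the Wronskian determinant and $\Delta(x_1,\dots,x_r)=\prod_{i<j}(x_j-x_i)$ is the Vandermonde determinant ($A_\emptyset=1$). $\Lambda$ is the ring of symmetric functions, $h_m$ the complete homogeneous symmetric functions, $s_\lambda$ the Schur functions, and $\varphi_A:\Lambda\to\mathbb{R}[x]$ is the ring homomorphism defined by $\varphi_A(h_m)=A_m/m!$ for $m\ge1$. $H(\lambda)$ is the product of the hook lengths of $\lambda$ and $F_\lambda$ is the number of standard Young tableaux of shape $\lambda$; $|\lambda|$ is the size of $\lambda$. *)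

(* Defs.v *)
From HB Require Import structures.
From mathcomp Require Import all_boot all_order all_algebra.
From mathcomp Require Import mpoly.
From mathcomp Require Import reals.

Set Implicit Arguments.
Unset Strict Implicit.
Unset Printing Implicit Defensive.

Import Order.TTheory GRing.Theory Num.Theory.
Local Open Scope ring_scope.

Definition appell (R : nzRingType) (A : nat -> {poly R}) : Prop :=
  A 0%N = 1 /\ forall n : nat, (A n.+1)^`() = (n.+1)%:R *: A n.

Definition is_partition (la : seq nat) : bool :=
  sorted geq la && all (fun x => 0 < x)%N la.

Definition part (la : seq nat) (i : nat) : nat := nth 0%N la i.

Definition conj_part (la : seq nat) (j : nat) : nat := count (fun x => j < x)%N la.

Definition cell (la : seq nat) :=
  {p : 'I_(size la) * 'I_(head 0%N la) | (p.2 < part la p.1)%N}.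

(* hook length of cell (i,j): arm + leg + 1 *)
Definition hook (la : seq nat) (c : cell la) : nat :=
  let i := nat_of_ord (sval c).1 in let j := nat_of_ord (sval c).2 in
  ((part la i - j) + (conj_part la j - i) - 1)%N.

Definition hook_prod (la : seq nat) : nat := (\prod_(c : cell la) hook c)%N.

Definition psize (la : seq nat) : nat := sumn la.

Definition is_syt (la : seq nat) (T : {ffun cell la -> 'I_(psize la)}) : bool :=
  injectiveb T &&
  [forall c : cell la, forall d : cell la,
     ((((sval c).1 == (sval d).1) && ((sval c).2 < (sval d).2)%N) ==> (T c < T d)%N) &&
     ((((sval c).2 == (sval d).2) && ((sval c).1 < (sval d).1)%N) ==> (T c < T d)%N)].

Definition num_syt (la : seq nat) : nat :=
  #|[set T : {ffun cell la -> 'I_(psize la)} | is_syt T]|.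

(* (n_1,...,n_r) = (lambda_r, lambda_{r-1}+1, ..., lambda_1 + r - 1); 0-indexed *)
Definition wr_index (la : seq nat) (j : nat) : nat :=
  (part la (size la - 1 - j) + j)%N.

Definition wronskian (R : nzRingType) (r : nat) (f : 'I_r -> {poly R}) : {poly R} :=
  \det (\matrix_(i < r, j < r) (f j)^`(i)).

Definition vdm_index (la : seq nat) : nat :=
  (\prod_(i < size la) \prod_(j < size la | (i < j)%N) (wr_index la j - wr_index la i))%N.

Definition wronskian_appell (R : fieldType) (A : nat -> {poly R}) (la : seq nat)
  : {poly R} :=
  (vdm_index la)%:R^-1 *:
    wronskian (fun j : 'I_(size la) => A (wr_index la j)).

Definition hsym (R : nzRingType) (N k : nat) : {mpoly R[N]} :=
  \sum_(m : 'X_{1..N < k.+1} | mdeg m == k) 'X_[bmnm m].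

Definition is_ssyt (la : seq nat) (N : nat) (T : {ffun cell la -> 'I_N}) : bool :=
  [forall c : cell la, forall d : cell la,
     ((((sval c).1 == (sval d).1) && ((sval c).2 < (sval d).2)%N) ==> (T c <= T d)%N) &&
     ((((sval c).2 == (sval d).2) && ((sval c).1 < (sval d).1)%N) ==> (T c < T d)%N)].

Definition schur (R : nzRingType) (N : nat) (la : seq nat) : {mpoly R[N]} :=
  \sum_(T : {ffun cell la -> 'I_N} | is_ssyt T) \prod_(c : cell la) 'X_(T c).

Definition htuple (R : nzRingType) (N : nat) : N.-tuple {mpoly R[N]} :=
  [tuple hsym R N i.+1 | i < N].

(* phi_A applied to Q(h_1,...,h_N): Q(A_1/1!, ..., A_N/N!) *)
Definition phiA_poly (R : fieldType) (A : nat -> {poly R}) (N : nat)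
  (Q : {mpoly R[N]}) : {poly R} :=
  mmap (@polyC R) (fun i : 'I_N => (i.+1)`!%:R^-1 *: A i.+1) Q.

(* Main.v *)
Require Import Defs.
From HB Require Import structures.
From mathcomp Require Import all_boot all_order all_algebra.
From mathcomp Require Import perm mpoly.
From mathcomp Require Import reals.
From mathcomp Require Import zify.
Import Order.TTheory GRing.Theory Num.Theory.
Set Implicit Arguments.
Unset Strict Implicit.
Unset Printing Implicit Defensive.
Local Open Scope ring_scope.

(** Write [n_j] for [wr_index la j].  By the Jacobi-Trudi identity
    [s_la = det (h_(la_i - i + j))], and the [h]'s are algebraically independent,
    so [phi_A s_la = det (A_(la_i - i + j) / (la_i - i + j)!)].  Since the [i]-th
    derivative of [A_n] is [n ^_ i * A_(n - i)], transposing and reversing this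
    determinant turns it into the Wronskian divided by [\prod_j n_j!].  The hook
    lengths of a row of [la] complement the differences of the [n_j], whence
    [H(la) * Delta(n) = \prod_j n_j!].  Finally [F_la] is the coefficient of
    [x_1 ... x_N] in [s_la], that is [N! * det (1 / (la_i - i + j)!)], and the
    latter determinant is [Delta(n) / \prod_j n_j!] by the Wronskian computation
    with [A_n] replaced by [1].

    Jacobi-Trudi is proved by adding one variable at a time: the tableau sum and
    the determinant satisfy the same recursion over the partitions that
    interlace with [la]. *)

(** * Jacobi-Trudi determinants *)

(** The term of [v] of index [n - i], with value 0 when that index is negative. Keeping [n] and [i]
    apart avoids truncated subtraction. *)
Definition shifted (S : pzRingType) (v : nat -> S) (n i : nat) : S :=
  if (i <= n)%N then v (n - i)%N else 0.

Lemma shiftedDD (S : pzRingType) (v : nat -> S) n i d :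
  shifted v (n + d)%N (i + d)%N = shifted v n i.
Proof. by rewrite /shifted leq_add2r subnDr. Qed.

Lemma shifted_lt (S : pzRingType) (v : nat -> S) n i :
  (n < i)%N -> shifted v n i = 0.
Proof. by rewrite /shifted ltnNge => /negbTE ->. Qed.

(** The sequence [v] is left arbitrary: it becomes [h_n], [A_n / n!], [1 / n!] or a sequence of
    variables. *)
Definition jacobi_trudi (S : comPzRingType) (r : nat) (v : nat -> S)
    (la : 'I_r -> nat) : S :=
  \det (\matrix_(i < r, j < r) shifted v (la i + j)%N i).

(** Multilinearity in the rows: [f] chooses one summand from each row. *)
Lemma det_sum_rows (S : comPzRingType) (r : nat) (B : finType)
    (c : 'I_r -> B -> S) (G : 'I_r -> B -> 'I_r -> S) :
  \det (\matrix_(i, j) \sum_b c i b * G i b j) =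
  \sum_(f : {ffun 'I_r -> B})
     (\prod_i c i (f i)) * \det (\matrix_(i, j) G i (f i) j).
Proof.
rewrite /determinant.
under eq_bigr => s _.
  under eq_bigr => i _ do rewrite mxE.
  rewrite bigA_distr_bigA big_distrr /=.
  over.
rewrite exchange_big; apply: eq_bigr => f _ /=.
rewrite big_distrr; apply: eq_bigr => s _ /=.
rewrite big_split mulrCA /=; congr (_ * (_ * _)).
by apply: eq_bigr => i _; rewrite mxE.
Qed.

(* The complete homogeneous polynomial of degree n in x 0, ..., x k.-1. *)
Fixpoint hlev (S : pzRingType) (x : nat -> S) (k n : nat) : S :=
  if k is k'.+1 then \sum_(a < n.+1) x k' ^+ a * hlev x k' (n - a)
  else (n == 0%N)%:R.

(** The terms with [a > n - i] vanish, so any bound [M > n] will do; this freedom lets two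
    expansions be aligned. *)
Lemma shifted_hlevS (S : pzRingType) (x : nat -> S) k n i M : (n < M)%N ->
  shifted (hlev x k.+1) n i =
  \sum_(0 <= a < M) x k ^+ a * shifted (hlev x k) n (i + a).
Proof.
move=> lt_nM; have [le_in|lt_ni] := leqP i n; last first.
  rewrite shifted_lt // big1 // => a _.
  by rewrite shifted_lt ?mulr0 // ltn_addr.
rewrite {1}/shifted le_in /= (big_cat_nat (n := (n - i).+1)) //=; last by lia.
rewrite [X in _ = _ + X]big_nat [X in _ = _ + X]big1 ?addr0; last first.
  by move=> a Ha; rewrite shifted_lt ?mulr0 //; lia.
rewrite big_mkord; apply: eq_bigr => -[a Ha] _ /=.
by rewrite /shifted subnDA (_ : (i + a <= n)%N) //; lia.
Qed.

(** The subtracted expansion is the tail, from [a = c] on, of the first one. *)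
Lemma shifted_hlev_diff (S : pzRingType) (x : nat -> S) k n i c :
  shifted (hlev x k.+1) n i - x k ^+ c * shifted (hlev x k.+1) n (i + c) =
  \sum_(0 <= a < c) x k ^+ a * shifted (hlev x k) n (i + a).
Proof.
rewrite (@shifted_hlevS _ _ _ _ _ (c + n.+1)); last by lia.
rewrite (@shifted_hlevS _ _ _ n (i + c) n.+1) //.
rewrite (big_cat_nat (n := c)) //=; last by lia.
rewrite -{2}[c]add0n [X in _ + X - _]big_addn addKn big_distrr /=.
rewrite -[RHS]addr0 -addrA; congr (_ + _); apply/eqP; rewrite subr_eq0; apply/eqP.
by apply: eq_bigr => a _; rewrite mulrA -exprD [(c + a)%N]addnC addnA addnAC.
Qed.

(** * Branching rule for Jacobi-Trudi determinants *)

Section Branching.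

Variables (r m : nat).
Implicit Types la mu : {ffun 'I_r -> 'I_m.+1}.

(** The sum has at most one term; it is empty, hence 0, after the last row. *)
Definition next_row la (i : nat) : nat := (\sum_(k < r | k == i.+1 :> nat) la k)%N.

(** Equivalently, [la / mu] is a horizontal strip. *)
Definition interlaces la mu : bool :=
  [forall i : 'I_r, (next_row la i <= mu i)%N && (mu i <= la i)%N].

Definition decreasing la : bool :=
  [forall i : 'I_r, forall k : 'I_r, (i <= k)%N ==> (la k <= la i)%N].

Lemma next_row_lt la (i k : 'I_r) : k = i.+1 :> nat -> next_row la i = la k.
Proof.
by move=> Hk; rewrite /next_row (big_pred1 k) // => j; rewrite -Hk.
Qed.

Lemma next_row_last la (i : 'I_r) : (r <= i.+1)%N -> next_row la i = 0%N.
Proof.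
move=> Hr; rewrite /next_row big_pred0 // => j.
by apply/negbTE/eqP => Hj; have := ltn_ord j; lia.
Qed.

Lemma next_row_le la (i : 'I_r) : decreasing la -> (next_row la i <= la i)%N.
Proof.
move=> /forallP dec; have [lt_ir|le_ri] := ltnP i.+1 r.
  rewrite (@next_row_lt _ _ (Ordinal lt_ir)) //.
  by move: (dec i) => /forallP/(_ (Ordinal lt_ir))/implyP; apply => /=.
by rewrite next_row_last.
Qed.

Lemma interlaces_decreasing la mu :
  decreasing la -> interlaces la mu -> decreasing mu.
Proof.
move=> /forallP dec /forallP inter.
apply/forallP => i; apply/forallP => k; apply/implyP => le_ik.
have [/val_inj-> //|ne_ik] := eqVneq (i : nat) k.
have lt_ir : (i.+1 < r)%N by have := ltn_ord k; lia.
move: (inter i) => /andP[+ _]; rewrite (@next_row_lt _ _ (Ordinal lt_ir)) //.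
apply: leq_trans; move: (inter k) => /andP[_ Hk]; apply: leq_trans Hk _.
move: (dec (Ordinal lt_ir)) => /forallP/(_ k)/implyP; apply => /=; lia.
Qed.

Variables (S : comPzRingType) (x : nat -> S).

(* Subtracting from each row the multiple of the next one that cancels the
   tail of its expansion leaves exactly the terms that interlace with [la]. *)
Lemma jacobi_trudi_hlevS k la : decreasing la ->
  jacobi_trudi (hlev x k.+1) (fun i => la i) =
  \sum_(mu | interlaces la mu)
    (\prod_i x k ^+ (la i - mu i)) * jacobi_trudi (hlev x k) (fun i => mu i).
Proof.
move=> dec.
pose c (i : 'I_r) (b : 'I_m.+1) : S :=
  if (next_row la i <= b)%N && (b <= la i)%N then x k ^+ (la i - b) else 0.
(* Unitriangular matrix of the row operations; the exponent is the number of values [b] with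
   [next_row la i <= b <= la i]. *)
pose U : 'M[S]_r := \matrix_(i, j) ((i == j)%:R -
   (j == i.+1 :> nat)%:R * x k ^+ (la i - next_row la i).+1).
pose M : 'M[S]_r := \matrix_(i, j) shifted (hlev x k.+1) (la i + j) i.
have detU : \det U = 1.
  rewrite -det_tr det_trig.
    apply: big1 => i _; rewrite !mxE eqxx.
    by rewrite (_ : (i == i.+1 :> nat) = false) ?mul0r ?subr0 //; lia.
  apply/is_trig_mxP => i j lt_ij; rewrite !mxE.
  rewrite (_ : (j == i) = false); last by apply/eqP => E; move: lt_ij; rewrite E ltnn.
  by rewrite (_ : (i == j.+1 :> nat) = false) ?mul0r ?subr0 //; lia.
transitivity (\det (U *m M)); first by rewrite det_mulmx detU mul1r.
transitivity (\det (\matrix_(i, j) \sum_b c i b * shifted (hlev x k) (b + j) i)).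
  congr (\det _); apply/matrixP => i j; rewrite !mxE.
  transitivity (shifted (hlev x k.+1) (la i + j) i - x k ^+ (la i - next_row la i).+1 *
     shifted (hlev x k.+1) (la i + j) (i + (la i - next_row la i).+1)).
    under eq_bigr => l _ do rewrite !mxE mulrBl.
    rewrite big_split /= (bigD1 i) //= eqxx mul1r big1 ?addr0; last first.
      by move=> l /negbTE; rewrite eq_sym => ->; rewrite mul0r.
    congr (_ + _); rewrite sumrN; congr (- _).
    have [lt_ir|le_ri] := ltnP i.+1 r.
      rewrite (bigD1 (Ordinal lt_ir)) //= eqxx mul1r big1 ?addr0; last first.
        move=> l ne; rewrite (_ : (l == i.+1 :> nat) = false) ?mul0r //.
        by apply: contraNF ne => /eqP E; apply/eqP/val_inj.
      have nxE := @next_row_lt la i (Ordinal lt_ir) erefl.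
      have := next_row_le i dec; rewrite nxE => nle; congr (_ * _).
      rewrite -(@shiftedDD _ _ (la (Ordinal lt_ir) + j) i.+1 (la i - la (Ordinal lt_ir))).
      by congr (shifted _ _ _); lia.
    (* The last row has no successor, but the term to subtract is 0 there because its index is
       negative. *)
    rewrite shifted_lt ?mulr0; last first.
      by rewrite next_row_last //; have := ltn_ord j; lia.
    apply: big1 => l _; rewrite (_ : (l == i.+1 :> nat) = false) ?mul0r //.
    by have := ltn_ord l; lia.
  rewrite shifted_hlev_diff.
  have nle := next_row_le i dec.
  transitivity (\sum_(0 <= b < m.+1)
    if (next_row la i <= b)%N && (b <= la i)%N then
       x k ^+ (la i - b) * shifted (hlev x k) (b + j) i else 0); last first.
    by rewrite big_mkord; apply: eq_bigr => b _; rewrite /c; case: ifP; rewrite ?mul0r.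
  have le_la : (la i <= m)%N by rewrite -ltnS.
  rewrite [RHS](big_cat_nat (n := next_row la i)) //=; last by lia.
  rewrite [X in _ = X + _]big_nat [X in _ = X + _]big1 ?add0r; last first.
    by move=> b Hb; case: ifP => //; lia.
  rewrite [RHS](big_cat_nat (n := (la i).+1)) //=; [|by lia..].
  rewrite [X in _ = _ + X]big_nat [X in _ = _ + X]big1 ?addr0; last first.
    by move=> b Hb; case: ifP => //; lia.
  (* The substitution [b = la i - a] turns powers of [x k] into parts of [mu], which reverses the
     sum. *)
  rewrite -{2}[next_row la i]add0n big_addn big_nat_rev /= subSn // add0n.
  rewrite big_nat [RHS]big_nat; apply: eq_bigr => b Hb.
  rewrite ifT; last by lia.
  congr (_ ^+ _ * _); first by lia.
  rewrite -(@shiftedDD _ _ (_ + j) i (la i - next_row la i - b)).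
  by congr (shifted _ _ _); lia.
(* A choice of [b] in each row is a candidate [mu]; its weight is 0 unless it interlaces with
   [la]. *)
rewrite det_sum_rows [RHS]big_mkcond /=; apply: eq_bigr => mu _.
case: ifPn => [/forallP inter|].
  congr (_ * _); apply: eq_bigr => i _; rewrite /c.
  by rewrite inter.
rewrite negb_forall => /existsP[i /negbTE ni].
by rewrite (bigD1 i) //= /c ni !mul0r.
Qed.

End Branching.

(** * Semistandard tableaux *)

(** Serves to recover the length of a row of a tableau from the number of its small entries. *)
Lemma card_initial_segment (m : nat) (p : pred 'I_m) :
  (forall i j : 'I_m, (i <= j)%N -> p j -> p i) ->
  forall j : 'I_m, (j < #|p|)%N = p j.
Proof.
move=> down j; apply/idP/idP => [lt_j|pj].
  apply: contraLR lt_j => npj; rewrite -leqNgt.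
  have /subset_leq_card : p \subset [pred i : 'I_m | (i < j)%N].
    apply/subsetP => i pi; rewrite inE ltnNge; apply: contra npj => le_ji.
    exact: down le_ji pi.
  move=> /leq_trans; apply.
  by rewrite -sum1_card (big_ord_narrow (ltnW (ltn_ord j))) /= sum1_card card_ord.
have /subset_leq_card : [pred i : 'I_m | (i < j.+1)%N] \subset p.
  by apply/subsetP => i; rewrite inE ltnS => le_ij; apply: down le_ij pj.
apply: leq_trans.
by rewrite -sum1_card (big_ord_narrow (ltn_ord j)) /= sum1_card card_ord.
Qed.

Section Tableaux.

Variables (r m N : nat).
Implicit Types la mu : {ffun 'I_r -> 'I_m.+1}.
Implicit Types T : {ffun 'I_r * 'I_m -> 'I_N.+1}.

Definition in_shape la (c : 'I_r * 'I_m) : bool := (c.2 < la c.1)%N.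

(* Semistandard fillings of [la] with entries below [k], extended to the whole
   [r] x [m] box by the out-of-range entry [N]. *)
Definition tableau (k : nat) la T : bool :=
  [forall c, if in_shape la c then (T c < k)%N else T c == ord_max] &&
  [forall c, forall d, in_shape la c ==> in_shape la d ==>
     ((((c.1 == d.1) && (c.2 < d.2)%N) ==> (T c <= T d)%N) &&
      (((c.2 == d.2) && (c.1 < d.1)%N) ==> (T c < T d)%N))].

Lemma tableauP k la T :
  reflect [/\ forall c, in_shape la c -> (T c < k)%N,
              forall c, ~~ in_shape la c -> T c = ord_max,
              forall i (j j' : 'I_m), in_shape la (i, j) -> in_shape la (i, j') ->
                (j < j')%N -> (T (i, j) <= T (i, j'))%N &
              forall (i i' : 'I_r) j, in_shape la (i, j) -> in_shape la (i', j) ->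
                (i < i')%N -> (T (i, j) < T (i', j))%N]
          (tableau k la T).
Proof.
apply: (iffP andP) => [[/forallP Hk /forallP Hs]|[H1 H2 H3 H4]]; split.
- by move=> c Hc; have := Hk c; rewrite Hc.
- by move=> c Hc; have := Hk c; rewrite (negbTE Hc) => /eqP.
- move=> i j j' Hc Hd lt_jj; move: (Hs (i, j)) => /forallP/(_ (i, j')).
  by rewrite Hc Hd /= eqxx lt_jj => /andP[].
- move=> i i' j Hc Hd lt_ii; move: (Hs (i, j)) => /forallP/(_ (i', j)).
  by rewrite Hc Hd /= eqxx lt_ii => /andP[].
- by apply/forallP => c; case: ifPn => [/H1|/H2 ->].
- apply/forallP => -[i j]; apply/forallP => -[i' j'].
  apply/implyP => Hc; apply/implyP => Hd /=; apply/andP; split; apply/implyP => /andP[/eqP E lt].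
    by rewrite -{i'}E in Hd *; apply: H3.
  by rewrite -{j'}E in Hd *; apply: H4.
Qed.

Definition sub_shape (k : nat) T : {ffun 'I_r -> 'I_m.+1} :=
  [ffun i => inord #|[pred j | (T (i, j) < k)%N]|].

Definition sub_tableau (k : nat) T : {ffun 'I_r * 'I_m -> 'I_N.+1} :=
  [ffun c => if (T c < k)%N then T c else ord_max].

(** Inverse of the removal of the entries [k]: it writes [k] in all cells of [la / mu]. *)
Definition fill_strip (k : nat) la mu T : {ffun 'I_r * 'I_m -> 'I_N.+1} :=
  [ffun c => if in_shape la c && ~~ in_shape mu c then inord k else T c].

(** Rows increase weakly and the cells outside [la] hold [N > k], so the entries below [k] form an
    initial segment of each row. *)
Lemma in_sub_shape k la T c : (k < N)%N -> tableau k.+1 la T ->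
  in_shape (sub_shape k T) c = (T c < k)%N.
Proof.
case: c => i j lt_kN /tableauP[Hlt Hout Hrow _].
have val : sub_shape k T i = #|[pred j | (T (i, j) < k)%N]| :> nat.
  rewrite ffunE inordK // ltnS.
  by rewrite (leq_trans (max_card _)) // card_ord.
rewrite /in_shape val /= card_initial_segment // => {}j j'.
rewrite leq_eqVlt => /orP[/eqP/val_inj-> //|lt_jj] /= Tj'.
have sj' : in_shape la (i, j').
  by apply: contraLR Tj' => /Hout ->; rewrite -leqNgt /=; lia.
have sj : in_shape la (i, j) by rewrite /in_shape /= (ltn_trans lt_jj).
exact: leq_ltn_trans (Hrow _ _ _ sj sj' lt_jj) Tj'.
Qed.

Lemma le_shape la mu :
  (forall c, in_shape mu c -> in_shape la c) -> forall i, (mu i <= la i)%N.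
Proof.
move=> sub i; rewrite leqNgt; apply/negP => lt.
have lt_m : (la i < m)%N by rewrite (leq_trans lt) // -ltnS.
by have := sub (i, Ordinal lt_m) lt; rewrite /in_shape /= ltnn.
Qed.

Lemma sub_shape_interlaces k la T : (k < N)%N -> decreasing la ->
  tableau k.+1 la T -> interlaces la (sub_shape k T).
Proof.
move=> lt_kN dec tT; have inE c := in_sub_shape c lt_kN tT.
have /tableauP[Hlt Hout Hrow Hcol] := tT.
apply/forallP => i; apply/andP; split; last first.
  apply: le_shape => c; rewrite inE; apply: contraLR => /Hout ->.
  by rewrite -leqNgt /=; lia.
have [lt_ir|le_ri] := ltnP i.+1 r; last by rewrite next_row_last.
rewrite (@next_row_lt _ _ _ _ (Ordinal lt_ir)) // leqNgt; apply/negP => lt.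
have lt_m : (sub_shape k T i < m)%N by rewrite (leq_trans lt) // -ltnS.
(* If row [i] of the subshape ended before column [la (i + 1)], then in column [j] the entry of row
   [i] would be at least [k] and the one below it larger than [k], which is excluded. *)
pose j := Ordinal lt_m; have : ~~ in_shape (sub_shape k T) (i, j).
  by rewrite /in_shape ltnn.
have s1 : in_shape la (Ordinal lt_ir, j) by [].
have s0 : in_shape la (i, j).
  have /forallP/(_ i)/forallP/(_ (Ordinal lt_ir))/implyP := dec.
  by move=> /(_ (leqnSn _)); apply: leq_trans lt.
rewrite inE -leqNgt => Tk.
have := Hlt _ s1; rewrite ltnS leqNgt => /negP; apply.
by apply: leq_ltn_trans Tk _; apply: Hcol.
Qed.

Lemma sub_tableauP k la T : (k < N)%N -> tableau k.+1 la T ->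
  tableau k (sub_shape k T) (sub_tableau k T).
Proof.
move=> lt_kN tT; have inE c := in_sub_shape c lt_kN tT.
have /tableauP[Hlt Hout Hrow Hcol] := tT.
have sub c : (T c < k)%N -> in_shape la c.
  by apply: contraLR => /Hout ->; rewrite -leqNgt /=; lia.
apply/tableauP; split.
- by move=> c; rewrite inE ffunE => Hc; rewrite Hc.
- by move=> c; rewrite inE ffunE => /negbTE ->.
- move=> i j j'; rewrite !inE => H1 H2 lt; rewrite !ffunE H1 H2.
  by apply: Hrow => //; apply: sub.
- move=> i i' j; rewrite !inE => H1 H2 lt; rewrite !ffunE H1 H2.
  by apply: Hcol => //; apply: sub.
Qed.

Lemma fill_stripK k la T : (k < N)%N -> decreasing la -> tableau k.+1 la T ->
  fill_strip k la (sub_shape k T) (sub_tableau k T) = T.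
Proof.
move=> lt_kN dec tT; have inE c := in_sub_shape c lt_kN tT.
have /tableauP[Hlt Hout Hrow Hcol] := tT.
apply/ffunP => c; rewrite !ffunE inE.
case: ifP => [/andP[sc]|]; last first.
  by case: (ltnP (T c) k) => //; rewrite andbT => _ /negbT /Hout ->.
rewrite -leqNgt => le_kT; apply: val_inj; rewrite /= inordK; last by lia.
by have := Hlt _ sc; lia.
Qed.

Lemma fill_strip_tableau k la mu T : (k < N)%N -> decreasing la ->
  interlaces la mu -> tableau k mu T -> tableau k.+1 la (fill_strip k la mu T).
Proof.
move=> lt_kN dec /forallP inter /tableauP[Hlt Hout Hrow Hcol].
have sub c : in_shape mu c -> in_shape la c.
  by move=> /leq_trans; apply; case/andP: (inter c.1).
(* By interlacing, a cell with a cell of [la] below it lies in [mu], so a new entry [k] is always at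
   the bottom of its column. *)
have above (i i' : 'I_r) j : (i < i')%N -> in_shape la (i', j) -> in_shape mu (i, j).
  move=> lt_ii s; have lt_ir : (i.+1 < r)%N by have := ltn_ord i'; lia.
  have /andP[+ _] := inter i; rewrite (@next_row_lt _ _ _ _ (Ordinal lt_ir)) //.
  apply: leq_trans; apply: leq_trans s _.
  by have /forallP/(_ (Ordinal lt_ir))/forallP/(_ i')/implyP := dec; apply.
have fillk c : in_shape la c -> ~~ in_shape mu c -> fill_strip k la mu T c = k :> nat.
  by move=> s ns; rewrite ffunE s ns /= inordK //; lia.
have fillT c : in_shape mu c -> fill_strip k la mu T c = T c.
  by move=> s; rewrite ffunE s andbF.
apply/tableauP; split.
- move=> c s; case: (boolP (in_shape mu c)) => [sm|nm].
    by rewrite fillT // ltnW // ltnS; apply: Hlt.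
  by rewrite fillk.
- move=> c ns; rewrite ffunE (negbTE ns) /=; apply: Hout.
  by apply: contra ns; apply: sub.
- move=> i j j' s s' lt; case: (boolP (in_shape mu (i, j'))) => [sm'|nm'].
    have sm : in_shape mu (i, j) by rewrite /in_shape (ltn_trans lt).
    by rewrite !fillT //; apply: Hrow.
  rewrite (fillk _ s' nm'); case: (boolP (in_shape mu (i, j))) => [sm|nm].
    by rewrite fillT // ltnW //; apply: Hlt.
  by rewrite fillk.
- move=> i i' j s s' lt; have sm := above _ _ _ lt s'.
  rewrite (fillT _ sm); case: (boolP (in_shape mu (i', j))) => [sm'|nm'].
    by rewrite fillT //; apply: Hcol.
  by rewrite fillk //; apply: Hlt.
Qed.

Lemma sub_fill_strip k la mu T : (k < N)%N -> tableau k mu T ->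
  sub_tableau k (fill_strip k la mu T) = T.
Proof.
move=> lt_kN /tableauP[Hlt Hout _ _]; apply/ffunP => c; rewrite !ffunE.
case: (boolP (in_shape mu c)) => [sm|nm]; first by rewrite andbF Hlt.
rewrite andbT Hout //; case: (in_shape la c); last by case: ifP.
by rewrite inordK ?ltnn //; lia.
Qed.

Lemma fill_strip_shape k la mu T : (k < N)%N -> decreasing la ->
  interlaces la mu -> tableau k mu T -> sub_shape k (fill_strip k la mu T) = mu.
Proof.
move=> lt_kN dec inter tT.
have tF := fill_strip_tableau lt_kN dec inter tT.
have E c : in_shape (sub_shape k (fill_strip k la mu T)) c = in_shape mu c.
  rewrite (in_sub_shape _ lt_kN tF); have /tableauP[Hlt Hout _ _] := tT.
  rewrite ffunE; case: (boolP (in_shape mu c)) => [sm|nm]; first by rewrite andbF Hlt.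
  rewrite andbT; case: ifP => _; first by rewrite inordK ?ltnn //; lia.
  by rewrite Hout // ltnNge /=; apply/negbTE; lia.
apply/ffunP => i; apply: val_inj; apply/eqP; rewrite eqn_leq.
by rewrite !le_shape // => c; rewrite E.
Qed.

Variables (S : comPzRingType) (x : nat -> S).

Definition tableau_sum (k : nat) la : S :=
  \sum_(T | tableau k la T) \prod_(c | in_shape la c) x (T c).

Lemma prod_strip la mu (y : S) : interlaces la mu ->
  \prod_(c | in_shape la c && ~~ in_shape mu c) y = \prod_i y ^+ (la i - mu i).
Proof.
move=> /forallP inter.
rewrite -(pair_big_dep predT
  (fun i j => in_shape la (i, j) && ~~ in_shape mu (i, j)) (fun _ _ => y)) /=.
apply: eq_bigr => i _; have /andP[_ le_mu] := inter i.
rewrite prodr_const; congr (_ ^+ _).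
rewrite -sum1_card -(big_mkord (fun j => (j < la i) && ~~ (j < mu i))%N (fun=> 1%N)).
have le_la : (la i <= m)%N by rewrite -ltnS.
rewrite (big_cat_nat (n := mu i)) //=; last by lia.
rewrite big_nat_cond big_pred0 ?add0n; last by move=> j; lia.
rewrite (big_cat_nat (n := la i)) //=.
rewrite [X in (_ + X)%N]big_nat_cond [X in (_ + X)%N]big_pred0 ?addn0; last by move=> j; lia.
rewrite big_nat_cond (eq_bigl (fun j => (mu i <= j < la i)%N)); last by move=> j; lia.
by rewrite -big_nat sum_nat_const_nat muln1.
Qed.

(** Tableaux are grouped by the shape [mu] of their entries below [k]; within a group, [sub_tableau]
    and [fill_strip] are inverse bijections, and the strip contributes the powers of [x k]. *)
Lemma tableau_sumS k la : (k < N)%N -> decreasing la ->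
  tableau_sum k.+1 la =
  \sum_(mu | interlaces la mu) (\prod_i x k ^+ (la i - mu i)) * tableau_sum k mu.
Proof.
move=> lt_kN dec; rewrite /tableau_sum.
rewrite (partition_big (sub_shape k) (interlaces la)) /=; last first.
  by move=> T; apply: sub_shape_interlaces.
apply: eq_bigr => mu inter; rewrite big_distrr /=.
rewrite (reindex_onto (fill_strip k la mu) (sub_tableau k)) /=; last first.
  by move=> T /andP[tT /eqP <-]; apply: fill_stripK.
apply: eq_big => [T|T /andP[/andP[tT /eqP sT] /eqP fT]].
  apply/idP/idP => [/andP[/andP[tT /eqP sT] /eqP fT]|tT].
    by rewrite -fT -{1}sT; apply: sub_tableauP tT.
  by rewrite fill_strip_tableau ?fill_strip_shape ?sub_fill_strip ?eqxx.
have sub c : in_shape mu c -> in_shape la c.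
  by have /forallP H := inter; move=> /leq_trans; apply; case/andP: (H c.1).
rewrite (bigID (in_shape mu)) /= -(prod_strip (x k) inter) [LHS]mulrC.
congr (_ * _).
  by apply: eq_bigr => c /andP[sc Hc]; rewrite ffunE sc Hc inordK //; lia.
apply: eq_big => [c|c /andP[_ Hc]]; last by rewrite ffunE Hc andbF.
by case: (boolP (in_shape mu c)) => [/sub ->|]; rewrite ?andbF.
Qed.

(** With no variables, a nonempty shape has no tableau and its determinant has a zero first row; for
    the empty shape the matrix is the identity. *)
Lemma tableau_sum0 la : decreasing la ->
  tableau_sum 0 la = jacobi_trudi (hlev x 0) (fun i => la i).
Proof.
move=> dec; have [/existsP[i0 Hi0]|] := boolP [exists i, la i != 0 :> nat].
  have lt_r : (0 < r)%N by case: (r) i0 {dec Hi0} => // -[].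
  have la0 : (0 < la (Ordinal lt_r))%N.
    have /forallP/(_ (Ordinal lt_r))/forallP/(_ i0)/implyP/(_ (leq0n _)) := dec.
    by apply: leq_trans; rewrite lt0n.
  rewrite /tableau_sum big_pred0; last first.
    move=> T; apply/tableauP => -[Hlt _ _ _].
    have lt_m : (0 < m)%N by rewrite (leq_trans la0) // -ltnS.
    by have := Hlt (Ordinal lt_r, Ordinal lt_m) la0.
  apply/esym; rewrite /jacobi_trudi /determinant; apply: big1 => s _.
  rewrite (bigD1 (Ordinal lt_r)) //= mxE /shifted /= subn0.
  by rewrite (_ : _ == 0 = false)%N ?mul0r ?mulr0 //; apply/negbTE; rewrite -lt0n addn_gt0 la0.
move=> /existsPn H0; have la0 i : la i = 0 :> nat by apply/eqP; have := H0 i; rewrite negbK.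
have nin c : in_shape la c = false by rewrite /in_shape la0.
rewrite /tableau_sum (big_pred1 [ffun=> ord_max]); last first.
  move=> T; apply/tableauP/eqP => [[_ Hout _ _]|->].
    by apply/ffunP => c; rewrite ffunE Hout ?nin.
  by split => [c|c|i j j'|i i' j]; rewrite ?nin ?ffunE.
rewrite big_pred0 // /jacobi_trudi -(det1 S r); congr (\det _).
apply/matrixP => i j; rewrite !mxE la0 add0n /shifted /= -val_eqE /=.
case: ltngtP => [lt|lt|->]; rewrite ?subnn //.
by rewrite subn_eq0 leqNgt lt.
Qed.

Theorem tableau_sumE k la : (k <= N)%N -> decreasing la ->
  tableau_sum k la = jacobi_trudi (hlev x k) (fun i => la i).
Proof.
elim: k la => [|k IHk] la le_kN dec; first exact: tableau_sum0.
rewrite tableau_sumS // jacobi_trudi_hlevS //; apply: eq_bigr => mu inter.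
by rewrite IHk ?(interlaces_decreasing dec inter) // ltnW.
Qed.

End Tableaux.

(** * Schur and complete homogeneous polynomials *)

Lemma mcoeffXM (R : comNzRingType) n (k m : 'X_{1..n}) (p : {mpoly R[n]}) :
  ('X_[k] * p)@_m = if (k <= m)%MM then p@_(m - k) else 0.
Proof.
case: ifPn => [le_km|nle]; first by rewrite -{1}(submK le_km) addmC mulrC mcoeffMX.
rewrite mcoeffM big1 // => -[k1 k2] /= /eqP E; rewrite mcoeffX.
case: eqP => [E1|]; last by rewrite mul0r.
case/negP: nle; apply/mnm_lepP => i.
by rewrite E E1 mnmDE leq_addr.
Qed.

Lemma mcoeff_hsym (R : nzRingType) N k (m : 'X_{1..N}) :
  (hsym R N k)@_m = (mdeg m == k)%:R.
Proof.
rewrite /hsym raddf_sum /=; under eq_bigr => i _ do rewrite mcoeffX.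
have [dm|dm] := eqVneq (mdeg m) k; last first.
  apply: big1 => i /eqP di; case: eqP => // E.
  by case/eqP: dm; rewrite -E.
have lt_m : (mdeg m < k.+1)%N by rewrite dm.
rewrite (bigD1 (BMultinom lt_m)) /= ?dm ?eqxx // big1 ?addr0 // => i /andP[_ ne].
case: eqP => // E; case/negP: ne; apply/eqP; exact: val_inj.
Qed.

Lemma hsym0 (R : nzRingType) N : hsym R N 0 = 1.
Proof. by apply/mpolyP => m; rewrite mcoeff_hsym mcoeff1 mdeg_eq0. Qed.

(** Variables indexed by all naturals, 0 out of range, as [hlev] expects. *)
Definition xvar (R : nzRingType) (N i : nat) : {mpoly R[N]} :=
  if insub i is Some j then 'X_j else 0.

Lemma xvarE (R : nzRingType) N (i : 'I_N) : xvar R N i = 'X_i.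
Proof. by rewrite /xvar valK. Qed.

(** Level [k] does not involve the variable [k], so in the recursion only the power [a = m k]
    contributes to the coefficient of [m]. *)
Lemma mcoeff_hlev (R : comNzRingType) N k n (m : 'X_{1..N}) : (k <= N)%N ->
  (hlev (xvar R N) k n)@_m =
  ((mdeg m == n) && [forall i : 'I_N, (k <= i)%N ==> (m i == 0%N)])%:R.
Proof.
elim: k n m => [|k IHk] n m le_kN /=.
  transitivity (((n == 0%N) && (m == 0%MM))%:R : R).
    by case: eqP => _; rewrite ?mcoeff1 // mcoeff0.
  congr (_%:R); apply: congr1; apply/andP/andP.
    move=> [/eqP-> /eqP->]; rewrite mdeg0; split=> //.
    by apply/forallP => i; rewrite mnm0E.
  move=> [/eqP<- /forallP H]; suff -> : m = 0%MM by rewrite mdeg0.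
  by apply/mnmP => i; apply/eqP; rewrite mnm0E; have := H i.
pose kk := Ordinal le_kN; rewrite raddf_sum /=.
have leE a : (U_(kk) *+ a <= m)%MM = (a <= m kk)%N.
  apply/mnm_lepP/idP => [/(_ kk)|le i]; rewrite mulmnE mnm1E ?eqxx ?mul1n //.
  by case: eqP => [<-|_]; rewrite ?mul1n ?mul0n.
have coefE (a : 'I_n.+1) : (xvar R N k ^+ a * hlev (xvar R N) k (n - a))@_m =
    [&& mdeg m == n, a == m kk :> nat &
        [forall i : 'I_N, (k.+1 <= i)%N ==> (m i == 0%N)]]%:R.
  have le_an := ltnSE (ltn_ord a).
  rewrite (xvarE R kk) mpolyXn mcoeffXM leE.
  case: leqP => [le_am|lt_ma]; last by rewrite (gtn_eqF lt_ma) /= andbF.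
  rewrite IHk ?(ltnW le_kN) //; congr (_%:R); apply: congr1 => /=.
  have -> : (mdeg (m - U_(kk) *+ a) == n - a)%N = (mdeg m == n).
    have le : (U_(kk) *+ a <= m)%MM by rewrite leE.
    rewrite -{2}(submK le) mdegD mdegMn mdeg1 mul1n.
    by rewrite -(eqn_add2r a) subnK.
  congr (_ && _); apply/forallP/andP.
    move=> H; have := H kk; rewrite leqnn /= mnmBE mulmnE mnm1E eqxx mul1n => Hk.
    split; first by lia.
    apply/forallP => i; apply/implyP => lt_ki.
    have := H i; rewrite (ltnW lt_ki) /= mnmBE mulmnE mnm1E.
    by rewrite -val_eqE /= (ltn_eqF lt_ki) mul0n subn0.
  move=> [/eqP Ha /forallP H] i; apply/implyP => le_ki.
  rewrite mnmBE mulmnE mnm1E -val_eqE /=; have := H i.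
  case: ltngtP le_ki => // [lt_ki _ /=|Ek _ _]; first by rewrite mul0n subn0.
  have -> : i = kk by apply: val_inj.
  by rewrite mul1n Ha subnn.
under eq_bigr => a _ do rewrite coefE.
have [dm|] /= := eqVneq (mdeg m) n; last by rewrite big1.
have lt_m : (m kk < n.+1)%N.
  by rewrite ltnS -dm mdegE (bigD1 kk) //= leq_addr.
rewrite (bigD1 (Ordinal lt_m)) //= eqxx /= big1 ?addr0 // => a ne.
by rewrite (_ : (a == m kk :> nat) = false) //; apply: contraNF ne => /eqP E; apply/eqP/val_inj.
Qed.

Lemma hlev_hsym (R : comNzRingType) N n : hlev (xvar R N) N n = hsym R N n.
Proof.
apply/mpolyP => m; rewrite mcoeff_hlev // mcoeff_hsym.
rewrite (_ : [forall i, _] = true) ?andbT //.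
by apply/forallP => i; rewrite leqNgt ltn_ord.
Qed.

(** * Partitions as lists, and Jacobi-Trudi for Schur polynomials *)

Lemma part_le la i j : is_partition la -> (i <= j)%N -> (part la j <= part la i)%N.
Proof.
move=> /andP[srt _] le_ij; rewrite /part.
have [lt_j|] := ltnP j (size la); last by move=> ?; rewrite nth_default.
by apply: (sorted_leq_nth (rev_trans leq_trans) leqnn 0%N srt); rewrite ?inE //;
  apply: leq_ltn_trans lt_j.
Qed.

Lemma part_le_head la i : is_partition la -> (part la i <= head 0%N la)%N.
Proof. by move=> Hla; rewrite -nth0; apply: part_le. Qed.

Lemma big_cell (S : Type) (idx : S) (op : Monoid.com_law idx) la
    (F : 'I_(size la) * 'I_(head 0%N la) -> S) :
  \big[op/idx]_(c : cell la) F (val c) =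
  \big[op/idx]_(p : 'I_(size la) * 'I_(head 0%N la) | (p.2 < part la p.1)%N) F p.
Proof.
rewrite [RHS](reindex_omap (val : cell la -> _) insub) /=.
  by apply: eq_bigl => c; rewrite (valP c) valK eqxx.
by move=> p Hp; rewrite insubT.
Qed.

Section SchurTableaux.

Variables (R : comNzRingType) (la : seq nat) (N : nat).
Hypothesis laP : is_partition la.

Let shape : {ffun 'I_(size la) -> 'I_(head 0%N la).+1} :=
  [ffun i : 'I_(size la) => inord (part la i)].

Let shapeE i : shape i = part la i :> nat.
Proof. by rewrite ffunE inordK // ltnS part_le_head. Qed.

Let in_shapeE c : in_shape shape c = (c.2 < part la c.1)%N.
Proof. by rewrite /in_shape shapeE. Qed.

(** A bijection from semistandard fillings of the cells to the box fillings [tableau N shape]; the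
    default entry is the [N] required there. *)
Let extend (T : {ffun cell la -> 'I_N}) :
    {ffun 'I_(size la) * 'I_(head 0%N la) -> 'I_N.+1} :=
  [ffun p => if insub p is Some c then widen_ord (leqnSn N) (T c) else ord_max].

Let extend_val T (c : cell la) : extend T (val c) = T c :> nat.
Proof. by rewrite ffunE valK. Qed.

Let extend_inj : injective extend.
Proof.
move=> T1 T2 E; apply/ffunP => c; apply: val_inj.
by rewrite /= -!extend_val E.
Qed.

Let extend_tableau T : tableau N shape (extend T) = is_ssyt T.
Proof.
apply/tableauP/forallP => [[_ _ Hrow Hcol] c|H].
  apply/forallP => d; rewrite -!(extend_val T).
  have : in_shape shape (val c) by rewrite in_shapeE (valP c).
  have : in_shape shape (val d) by rewrite in_shapeE (valP d).
  change (sval c) with (val c); change (sval d) with (val d).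
  case: (val c) => i j; case: (val d) => i' j' /= sd sc.
  apply/andP; split; apply/implyP => /andP[/eqP E lt].
    by rewrite -{i'}E in sd *; apply: Hrow.
  by rewrite -{j'}E in sd *; apply: Hcol.
have Hcd p q (sp : in_shape shape p) (sq : in_shape shape q) :
    (((p.1 == q.1) && (p.2 < q.2)%N) ==> (extend T p <= extend T q)%N) &&
    (((p.2 == q.2) && (p.1 < q.1)%N) ==> (extend T p < extend T q)%N).
  rewrite in_shapeE in sp; rewrite in_shapeE in sq.
  have := H (Sub p sp); move/forallP/(_ (Sub q sq)).
  by rewrite -!(extend_val T) !SubK.
split.
- move=> p; rewrite in_shapeE => sp; have := extend_val T (Sub p sp).
  by rewrite SubK => ->.
- by move=> p; rewrite in_shapeE => np; rewrite ffunE insubF //; apply/negbTE.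
- move=> i j j' sp sq lt; have /andP[/implyP + _] := Hcd _ _ sp sq.
  by apply; rewrite /= eqxx.
- move=> i i' j sp sq lt; have /andP[_ /implyP] := Hcd _ _ sp sq.
  by apply; rewrite /= eqxx.
Qed.

Let extend_surj T : tableau N shape T -> exists T', extend T' = T.
Proof.
move=> /tableauP[Hlt Hout _ _].
have lt (c : cell la) : (T (val c) < N)%N by apply: Hlt; rewrite in_shapeE (valP c).
exists [ffun c => Ordinal (lt c)]; apply/ffunP => p; rewrite ffunE.
case: insubP => [c _ <-|np]; first by apply: val_inj; rewrite /= ffunE.
by rewrite Hout // in_shapeE.
Qed.

Lemma schur_jacobi_trudi :
  schur R N la = jacobi_trudi (hsym R N) (fun i : 'I_(size la) => part la i).
Proof.
transitivity (tableau_sum N (xvar R N) N shape); last first.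
  rewrite tableau_sumE //; last first.
    apply/forallP => i; apply/forallP => k; apply/implyP => le_ik.
    by rewrite !shapeE part_le.
  congr (\det _); apply/matrixP => i j; rewrite !mxE shapeE /shifted.
  by case: ifP; rewrite ?hlev_hsym.
rewrite /tableau_sum.
rewrite (reindex_omap extend (fun T => [pick T' | extend T' == T])); last first.
  move=> T /extend_surj[T' <-]; case: pickP => [T'' /eqP <- //|/(_ T')].
  by rewrite eqxx.
apply: eq_big => [T|T _].
  rewrite extend_tableau; case: pickP => [T' /eqP/extend_inj ->|/(_ T)].
    by rewrite eqxx andbT.
  by rewrite eqxx.
rewrite (eq_bigl _ _ in_shapeE) -big_cell; apply: eq_bigr => c _.
by rewrite extend_val xvarE.
Qed.

End SchurTableaux.

(** * Algebraic independence of the complete homogeneous polynomials *)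

Section DualSequence.

Variable S : comPzRingType.
Implicit Types u v : nat -> S.

Definition unital u n : S := if n is _.+1 then u n else 1.

(** The recursion needs all earlier terms, so the whole list of terms of index at most [k] is
    carried along. *)
Fixpoint duals u (k : nat) : seq S :=
  if k is k'.+1 then
    rcons (duals u k')
      (\sum_(i < k'.+1) (-1) ^+ i * u i.+1 * (duals u k')`_(k' - i))
  else [:: 1].

(* The inverse power series of [\sum_n (-1) ^+ n * unital u n * t ^+ n]. *)
Definition dual u n : S := (duals u n)`_n.

Lemma size_duals u k : size (duals u k) = k.+1.
Proof. by elim: k => //= k IHk; rewrite size_rcons IHk. Qed.

Lemma nth_duals u k n : (n <= k)%N -> (duals u k)`_n = dual u n.
Proof.
elim: k => [|k IHk]; first by case: n.
rewrite leq_eqVlt => /orP[/eqP -> //|lt]; rewrite /= nth_rcons size_duals lt.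
exact: IHk.
Qed.

Lemma dualS u n :
  dual u n.+1 = \sum_(i < n.+1) (-1) ^+ i * u i.+1 * dual u (n - i).
Proof.
rewrite {1}/dual /= nth_rcons size_duals ltnn eqxx.
by apply: eq_bigr => i _; rewrite nth_duals ?leq_subr.
Qed.

(** The summand [i = 0] is [v (k + 1)], so each relation determines this value from the earlier
    ones. *)
Lemma dual_uniq u v n : v 0%N = 1 ->
  (forall k, (k < n)%N ->
     \sum_(i < k.+2) (-1) ^+ i * unital u i * v (k.+1 - i)%N = 0) ->
  v n = dual u n.
Proof.
move=> v0; elim/ltn_ind: n => -[_ _|n IHn rec]; first by rewrite v0.
have := rec n (ltnSn n); rewrite big_ord_recl /= expr0 !mul1r subn0 => /eqP.
rewrite addr_eq0 => /eqP ->; rewrite dualS -sumrN; apply: eq_bigr => i _.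
rewrite /bump /= exprS !mulN1r !mulNr opprK subSS; congr (_ * _).
by apply: IHn => [|k lt_k]; [rewrite ltnS leq_subr|apply: rec]; lia.
Qed.

Lemma dual_rel u n :
  \sum_(i < n.+2) (-1) ^+ i * unital u i * dual u (n.+1 - i)%N = 0.
Proof.
rewrite big_ord_recl /= expr0 !mul1r subn0 dualS -big_split /=; apply: big1 => i _.
by rewrite /bump /= exprS mulN1r !mulNr subSS subrr.
Qed.

Lemma eq_dual u v n : (forall k, (0 < k <= n)%N -> u k = v k) -> dual u n = dual v n.
Proof.
move=> uv; apply: dual_uniq => // k lt_kn; rewrite -[RHS](dual_rel u k).
apply: eq_bigr => -[[|i] Hi] _ //=; rewrite uv //; lia.
Qed.

Lemma unital_dual u n : unital (dual u) n = dual u n.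
Proof. by case: n. Qed.

(** Reversing the summation shows that the defining relation is symmetric in the two sequences up to
    a global sign. *)
Lemma dualK u n : (0 < n)%N -> dual (dual u) n = u n.
Proof.
move=> n_gt0; rewrite [RHS](_ : _ = unital u n); last by case: n n_gt0.
apply/esym/dual_uniq => // k _.
rewrite (reindex_inj rev_ord_inj) /=.
rewrite -[RHS](mulr0 ((-1) ^+ k.+1)) -[X in _ = _ * X](dual_rel u k) big_distrr /=.
apply: eq_bigr => i _; rewrite subSS unital_dual.
have Hi := ltnSE (ltn_ord i); rewrite subKn //.
rewrite -[X in _ = (-1) ^+ X * _](subnK Hi) exprD !mulrA.
rewrite -[_ * _ * (-1) ^+ i]mulrA -expr2 sqrr_sign mulr1.
by rewrite -!mulrA [unital u i * _]mulrC.
Qed.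

End DualSequence.

Lemma rmorph_dual (S S' : comPzRingType) (f : {rmorphism S -> S'}) (u : nat -> S) n :
  f (dual u n) = dual (f \o u) n.
Proof.
apply: (@dual_uniq _ (f \o u) (f \o dual u)); first by rewrite /= rmorph1.
move=> k _; rewrite -[RHS](rmorph0 f) -(dual_rel u k) rmorph_sum.
apply: eq_bigr => -[i Hi] _; rewrite !rmorphM rmorphXn rmorphN1 /=; congr (_ * _ * _).
by case: i {Hi} => /=; rewrite ?rmorph1.
Qed.

(** * The alternating relation between elementary and complete homogeneous polynomials *)

Lemma mesym1_le n (h : {set 'I_n}) (m : 'X_{1..n}) :
  (mesym1 h <= m)%MM = (h \subset [set i | m i != 0%N]).
Proof.
apply/mnm_lepP/subsetP => [H i hi|H i].
  by have := H i; rewrite mnmE hi inE lt0n.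
by rewrite mnmE; case: (boolP (i \in h)) => // /H; rewrite inE lt0n.
Qed.

(** Both sides equal the product over all [i] of [1 - [i in A]]. *)
Lemma sum_sign_subset (R : comPzRingType) (I : finType) (A : {set I}) :
  \sum_(h : {set I} | h \subset A) (-1) ^+ #|h| = (A == set0)%:R :> R.
Proof.
transitivity (\prod_(i : I) (- (i \in A)%:R + 1) : R).
  rewrite bigA_distr big_mkcond /=; apply: eq_bigr => h _; case: ifPn => [/subsetP sub|].
    rewrite -big_mkcond /= (eq_bigr (fun=> -1)) ?prodr_const // => i hi.
    by rewrite sub.
  move=> /subsetPn[i hi nA]; rewrite (bigD1 i) //= hi (negbTE nA) oppr0 mul0r //.
have [->|/set0Pn[i Ai]] := eqVneq A set0.
  by rewrite big1 // => i _; rewrite inE oppr0 add0r.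
by rewrite (bigD1 i) //= Ai addNr mul0r.
Qed.

Lemma mcoeff_signM (R : comNzRingType) N i (p : {mpoly R[N]}) m :
  ((-1) ^+ i * p)@_m = (-1) ^+ i * p@_m.
Proof.
rewrite -[in LHS]signr_odd -[in RHS]signr_odd.
by case: (odd i); rewrite ?expr1 ?expr0 ?mulN1r ?mul1r ?mcoeffN.
Qed.

(** The coefficient of [m] is a signed count of its squarefree divisors, that is of the subsets of
    its support [A]; it cancels unless the support is empty. *)
Lemma mesym_hsym_rel (R : comNzRingType) N n :
  \sum_(i < n.+1) (-1) ^+ i * mesym N R i * hsym R N (n - i) = (n == 0%N)%:R.
Proof.
apply/mpolyP => m; set A := [set i | m i != 0%N].
transitivity (\sum_(h : {set 'I_N} | h \subset A) (-1) ^+ #|h| * (mdeg m == n)%:R : R).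
  rewrite raddf_sum /=.
  transitivity (\sum_(i < n.+1) \sum_(h : {set 'I_N} | h \subset A)
      (#|h| == i)%:R * ((-1) ^+ #|h| * (mdeg m == n)%:R) : R).
    apply: eq_bigr => i _; rewrite mesymE -mulrA mcoeff_signM big_distrl /=.
    rewrite raddf_sum /= big_distrr /= big_mkcond [RHS]big_mkcond.
    apply: eq_bigr => h _; rewrite mcoeffXM mesym1_le -/A.
    case: ifP => [/eqP hi|]; last by rewrite mul0r; case: ifP.
    case: ifP => [sub|]; last by rewrite mulr0.
    rewrite mul1r mcoeff_hsym hi; congr (_ * _%:R).
    have le : (mesym1 h <= m)%MM by rewrite mesym1_le.
    rewrite -[in RHS](submK le) mdegD mdeg_mesym1 hi.
    by have := ltn_ord i; lia.
  rewrite exchange_big /=; apply: eq_bigr => h sub; rewrite -big_distrl /=.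
  have [dm|] := eqVneq (mdeg m) n; last by rewrite !mulr0.
  have lt : (#|h| < n.+1)%N.
    rewrite ltnS -dm -mdeg_mesym1 -[X in (_ <= mdeg X)%N](@submK _ (mesym1 h)) ?mesym1_le //.
    by rewrite mdegD leq_addl.
  rewrite (bigD1 (Ordinal lt)) //= eqxx big1 ?addr0 ?mul1r // => i ne.
  case: eqP => // E; case/negP: ne; apply/eqP/val_inj; exact: esym.
rewrite -big_distrl /= sum_sign_subset.
have -> : (A == set0) = (m == 0%MM).
  apply/eqP/eqP => [/setP A0|m0].
    by apply/mnmP => i; have := A0 i; rewrite !inE mnm0E => /eqP.
  by apply/setP => i; rewrite !inE m0 mnm0E.
have [->|nz] := eqVneq m 0%MM.
  by rewrite mdeg0 mul1r eq_sym; case: eqP; rewrite ?mcoeff1 ?eqxx // mcoeff0.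
by rewrite mul0r; case: eqP => _; rewrite ?mcoeff1 ?(negbTE nz) // mcoeff0.
Qed.

Lemma hsym_dual (R : comNzRingType) N n : hsym R N n = dual (mesym N R) n.
Proof.
apply: dual_uniq => [|k _]; first exact: hsym0.
rewrite -[RHS](mesym_hsym_rel R N k.+1); apply: eq_bigr => -[[|i] Hi] _ //=.
by rewrite mesym0E.
Qed.

Lemma comp_mpolyA (R : comNzRingType) n k l (p : {mpoly R[n]})
    (lp : n.-tuple {mpoly R[k]}) (lq : k.-tuple {mpoly R[l]}) :
  (p \mPo lp) \mPo lq = p \mPo [tuple tnth lp i \mPo lq | i < n].
Proof.
rewrite (comp_mpolyEX p lp) raddf_sum [RHS]comp_mpolyEX /=; apply: eq_bigr => m _.
rewrite comp_mpolyZ !comp_mpolyX rmorph_prod /=; congr (_ *: _).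
by apply: eq_bigr => i _; rewrite rmorphXn /= tnth_mktuple.
Qed.

(** Formal stand-ins for the [h_n]: 1 at index 0, and the variable number [n - 1] at index [n]. *)
Definition xseq (R : nzRingType) (N n : nat) : {mpoly R[N]} :=
  if n is i.+1 then xvar R N i else 1.

Lemma comp_xseq (R : comNzRingType) N k (u : nat -> {mpoly R[k]}) n :
  (n <= N)%N ->
  xseq R N n \mPo [tuple u i.+1 | i < N] = unital u n.
Proof.
case: n => [|n] lt_nN /=; first by rewrite comp_mpoly1.
by rewrite (xvarE R (Ordinal lt_nN)) comp_mpolyXU -tnth_nth tnth_mktuple.
Qed.

Lemma comp_dual_xseq (R : comNzRingType) N k (u : nat -> {mpoly R[k]}) n :
  (n <= N)%N ->
  dual (xseq R N) n \mPo [tuple u i.+1 | i < N] = dual u n.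
Proof.
move=> le_nN; rewrite (rmorph_dual (comp_mpoly [tuple u i.+1 | i < N])).
apply: eq_dual => j Hj; rewrite /= comp_xseq; last by lia.
by case: j Hj.
Qed.

(* The substitution [P] expressing the [h]'s through the [e]'s is involutive,
   so the independence of the [e]'s passes to the [h]'s. *)
Lemma hsym_independent (R : comNzRingType) N (Q : {mpoly R[N]}) :
  Q \mPo htuple R N = 0 -> Q = 0.
Proof.
pose P := [tuple dual (xseq R N) i.+1 | i < N].
pose E := [tuple mesym N R i.+1 | i < N].
have PE : [tuple tnth P i \mPo E | i < N] = htuple R N.
  apply: eq_from_tnth => i; rewrite !tnth_mktuple.
  by rewrite comp_dual_xseq // hsym_dual.
have PP : [tuple tnth P i \mPo P | i < N] = [tuple 'X_i | i < N].
  apply: eq_from_tnth => i; rewrite !tnth_mktuple.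
  by rewrite comp_dual_xseq // dualK // /xseq xvarE.
(* Substituting the [e]'s in [Q \mPo P] gives [Q] at the [h]'s, which is 0; independence of the
   [e]'s kills [Q \mPo P], and a second substitution of [P] recovers [Q]. *)
move=> Qh; have QP0 : Q \mPo P = 0.
  by apply: msym_fundamental_un0; rewrite comp_mpolyA PE.
by rewrite -(comp_mpoly_id Q) -PP -comp_mpolyA QP0 comp_mpoly0.
Qed.

(** * Wronskians and Vandermonde determinants *)

(** The same permutation acts on rows and columns, so its sign appears twice. *)
Lemma det_rev (S : comPzRingType) r (M : 'M[S]_r) :
  \det (\matrix_(i, j) M (rev_ord i) (rev_ord j)) = \det M.
Proof.
pose s := perm (@rev_ord_inj r).
have -> : \matrix_(i, j) M (rev_ord i) (rev_ord j) = row_perm s (col_perm s M).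
  by apply/matrixP => i j; rewrite !mxE !permE.
rewrite row_permE col_permE !det_mulmx !det_perm odd_permV mulrCA.
by rewrite -signr_addb addbb mulr1.
Qed.

(** Since [n ^_ i * (n - i)! = n!], a factorial comes out of each column. The case [u = A] gives the
    Wronskian, the case [u = 1] the Vandermonde determinant. *)
Lemma det_ffact_mul (S : comPzRingType) (u v : nat -> S) la :
  (forall n, u n = n`!%:R * v n) ->
  \det (\matrix_(i < size la, j < size la)
      ((wr_index la j ^_ i)%:R * u (wr_index la j - i)%N)) =
  (\prod_(j < size la) (wr_index la j)`!%:R) *
    jacobi_trudi v (fun i : 'I_(size la) => part la i).
Proof.
move=> uv; rewrite /jacobi_trudi -[in RHS]det_tr -[in RHS]det_rev.
set M := (X in _ = _ * \det X).
have -> : \matrix_(i < size la, j < size la)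
      ((wr_index la j ^_ i)%:R * u (wr_index la j - i)%N) =
    M *m diag_mx (\row_j (wr_index la j)`!%:R).
  rewrite mul_mx_diag; apply/matrixP => i j; rewrite !mxE /=.
  have -> : shifted v (part la (size la - j.+1) + (size la - i.+1))
      (size la - j.+1) = shifted v (wr_index la j) i.
    rewrite -(@shiftedDD _ _ _ (size la - j.+1)%N i).
    rewrite -(@shiftedDD _ _ (wr_index la j) i (size la - j.+1)%N) /wr_index.
    have := ltn_ord i; have := ltn_ord j => Hj Hi.
    rewrite -subnDA add1n; congr (shifted _ _ _); lia.
  rewrite uv mulrA -natrM /shifted; case: leqP => [le|lt].
    by rewrite ffact_fact // mulrC.
  (* For [n_j < i] the falling factorial vanishes, in agreement with the default 0 of [shifted]. *)
  by rewrite ffact_small // mul0n !mul0r.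
rewrite det_mulmx det_diag mulrC; congr (_ * _).
by apply: eq_bigr => j _; rewrite mxE.
Qed.

Definition ffact_poly (S : comNzRingType) (i : nat) : {poly S} :=
  \prod_(t < i) ('X - (t%:R)%:P).

Lemma horner_ffact_poly (S : comNzRingType) i n :
  (ffact_poly S i).[n%:R] = (n ^_ i)%:R.
Proof.
elim: i => [|i IHi]; first by rewrite /ffact_poly big_ord0 hornerC.
rewrite /ffact_poly big_ord_recr /= hornerM IHi hornerXsubC ffactnSr natrM.
case: (leqP i n) => [le|lt]; first by rewrite natrB.
by rewrite ffact_small // !mul0r.
Qed.

(** Falling factorials are monic polynomials of degree [i] in [n_j], so the matrix is a
    unitriangular one times a Vandermonde matrix. *)
Lemma det_ffact (S : comNzRingType) r (n : 'I_r -> nat) :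
  \det (\matrix_(i < r, j < r) (n j ^_ i)%:R) =
  \prod_(i < r) \prod_(j < r | (i < j)%N) ((n j)%:R - (n i)%:R) :> S.
Proof.
pose C : 'M[S]_r := \matrix_(i, l) (ffact_poly S i)`_l.
have sz i : size (ffact_poly S i) = i.+1 by rewrite size_prod_XsubC /index_enum -enumT size_enum_ord.
have -> : \matrix_(i < r, j < r) (n j ^_ i)%:R =
    C *m Vandermonde r (\row_j (n j)%:R).
  apply/matrixP => i j; rewrite !mxE -horner_ffact_poly.
  rewrite (@horner_coef_wide _ r) ?sz //.
  by apply: eq_bigr => l _; rewrite !mxE.
rewrite det_mulmx det_Vandermonde det_trig; last first.
  by apply/is_trig_mxP => i j lt_ij; rewrite mxE nth_default // sz.
rewrite big1 ?mul1r; last first.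
  move=> i _; rewrite mxE; have := monic_prod_XsubC (index_enum 'I_i) xpredT (fun t => t%:R : S).
  by rewrite monicE lead_coefE -/(ffact_poly S i) sz /= => /eqP.
by do 2!apply: eq_bigr => ? _; rewrite !mxE.
Qed.

(** Makes the natural-number subtractions in [vdm_index] genuine differences. *)
Lemma wr_index_lt la (i j : 'I_(size la)) : is_partition la ->
  (i < j)%N -> (wr_index la i < wr_index la j)%N.
Proof.
move=> laP lt_ij; rewrite /wr_index.
have : (part la (size la - 1 - i) <= part la (size la - 1 - j))%N.
  by apply: part_le => //; lia.
lia.
Qed.

Lemma det_ffact_wr_index (S : comNzRingType) la : is_partition la ->
  \det (\matrix_(i < size la, j < size la) (wr_index la j ^_ i)%:R) =
  (vdm_index la)%:R :> S.
Proof.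
move=> laP; rewrite det_ffact /vdm_index natr_prod; apply: eq_bigr => i _.
rewrite natr_prod; apply: eq_bigr => j lt_ij.
by rewrite natrB // ltnW // wr_index_lt.
Qed.

Lemma derivn_appell (R : comNzRingType) (A : nat -> {poly R}) n i :
  appell A -> (A n)^`(i) = (n ^_ i)%:R *: A (n - i)%N.
Proof.
move=> [A0 AS]; elim: i => [|i IHi].
  by rewrite derivn0 ffactn0 scale1r subn0.
rewrite derivnS IHi derivZ ffactnSr natrM subnS -scalerA.
(* Once the index reaches 0, the derivative of [A 0 = 1] and the new factor [n - i] both vanish. *)
case: (n - i)%N => [|k]; last by rewrite AS.
by rewrite A0 derivC scale0r.
Qed.

Lemma wronskianE (R : fieldType) (A : nat -> {poly R}) la :
  (forall n, n.+1%:R != 0 :> R) -> appell A ->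
  wronskian (fun j : 'I_(size la) => A (wr_index la j)) =
  (\prod_(j < size la) (wr_index la j)`!)%:R *:
    jacobi_trudi (fun n => n`!%:R^-1 *: A n) (fun i : 'I_(size la) => part la i).
Proof.
move=> char0 appA.
have factN0 n : n`!%:R != 0 :> R by case: n`! (fact_gt0 n).
rewrite -mul_polyC rmorph_nat natr_prod -(@det_ffact_mul _ A); last first.
  move=> n; rewrite -[n`!%:R in RHS](rmorph_nat (@polyC R)) mul_polyC.
  by rewrite scalerA mulfV ?scale1r.
congr (\det _); apply/matrixP => i j; rewrite !mxE derivn_appell //.
by rewrite -[X in _ = X * _](rmorph_nat (@polyC R)) mul_polyC.
Qed.

Lemma vdm_indexE (R : fieldType) la :
  (forall n, n.+1%:R != 0 :> R) -> is_partition la ->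
  (vdm_index la)%:R = (\prod_(j < size la) (wr_index la j)`!)%:R *
    jacobi_trudi (fun n => n`!%:R^-1) (fun i : 'I_(size la) => part la i) :> R.
Proof.
move=> char0 laP; have factN0 n : n`!%:R != 0 :> R by case: n`! (fact_gt0 n).
rewrite -det_ffact_wr_index // natr_prod -(@det_ffact_mul _ (fun=> 1)); last first.
  by move=> n; rewrite mulfV.
by congr (\det _); apply/matrixP => i j; rewrite !mxE mulr1.
Qed.

(** * Hook lengths *)

Lemma conj_partP la j k : is_partition la ->
  (k < conj_part la j)%N = (j < part la k)%N.
Proof.
move=> /andP[+ _]; rewrite /conj_part /part.
elim: la k => [|x s IHs] k; first by rewrite nth_nil.
move=> srt; have srts := path_sorted srt.
have /allP ub : all (geq x) s by exact: (order_path_min (rev_trans leq_trans) srt).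
rewrite /=; case: (ltnP j x) => [lt_jx|le_xj]; first by case: k => [|k]; rewrite add1n ?ltnS ?IHs.
rewrite add0n (_ : count _ s = 0%N); last first.
  apply/eqP; rewrite -leqn0 leqNgt -has_count; apply/hasPn => y ys.
  by rewrite -leqNgt (leq_trans (ub y ys)).
case: k => [|k] /=; first by apply/esym/negbTE; rewrite -leqNgt.
apply/esym/negbTE; rewrite -leqNgt; have [lt_k|ge_k] := ltnP k (size s).
  by rewrite (leq_trans (ub _ (mem_nth _ lt_k))).
by rewrite nth_default.
Qed.

Definition hook_length (la : seq nat) (i j : nat) : nat :=
  ((part la i - j) + (conj_part la j - i) - 1)%N.

(* The hook lengths of row [i] together with the differences between
   [part la i + size la - 1 - i] and its lower analogues fill [1 .. that number]. *)
Lemma hook_row_prod la i : is_partition la -> (i < size la)%N ->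
  (\prod_(0 <= j < part la i) hook_length la i j *
   \prod_(i.+1 <= k < size la)
      ((part la i + (size la - 1 - i)) - (part la k + (size la - 1 - k))) =
   (part la i + (size la - 1 - i))`!)%N.
Proof.
move=> laP lt_ir; set r := size la; set l := (part la i + (r - 1 - i))%N.
pose d k := (l - (part la k + (r - 1 - k)))%N.
(* All factors of the left side. [L] has length [l], takes values in [1 .. l] and has no repetition,
   hence is a permutation of [1 .. l]. *)
pose L := [seq hook_length la i j | j <- index_iota 0 (part la i)] ++
          [seq d k | k <- index_iota i.+1 r].
have conjE j k := conj_partP j k laP.
have partD k k' : (k <= k')%N -> (part la k' <= part la k)%N by apply: part_le.
have conjD j j' : (j <= j')%N -> (conj_part la j' <= conj_part la j)%N.
  by move=> le_jj; apply: sub_count => x /=; apply: leq_ltn_trans.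
have conj_le j : (conj_part la j <= r)%N by apply: count_size.
have sizeL : size L = l.
  by rewrite size_cat !size_map !size_iota /l; rewrite -/r in lt_ir; lia.
have subL : {subset L <= index_iota 1 l.+1}.
  move=> x; rewrite mem_cat mem_index_iota => /orP[]/mapP[j]; rewrite mem_index_iota => Hj ->.
    have := conjE j i; have := conj_le j; rewrite /hook_length /l; lia.
  have := partD i j; rewrite /d /l; lia.
have uniqL : uniq L.
  rewrite cat_uniq; apply/and3P; split.
  - rewrite map_inj_in_uniq ?iota_uniq // => j j'; rewrite !mem_index_iota /hook_length => Hj Hj'.
    have := conjE j i; have := conjE j' i; have := conjD j j'; have := conjD j' j; lia.
  (* A hook length equal to a difference would force [conj_part la j - 1 - k = j - part la k] over
     the integers; by [conj_partP] exactly one of these sides is negative. *)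
  - apply/hasPn => x /mapP[k]; rewrite mem_index_iota => Hk ->.
    apply/mapP => -[j]; rewrite mem_index_iota /hook_length /d /l => Hj.
    have := conjE j i; have := conjE j k; have := partD i k; have := conj_le j; lia.
  - rewrite map_inj_in_uniq ?iota_uniq // => j j'; rewrite !mem_index_iota /d /l => Hj Hj'.
    have := partD j j'; have := partD j' j; have := partD i j; have := partD i j'; lia.
have [|_ eqL] := uniq_min_size uniqL subL; first by rewrite sizeL size_iota subn1.
have permL : perm_eq L (index_iota 1 l.+1) by apply: uniq_perm; rewrite ?iota_uniq.
by rewrite fact_prod -(perm_big _ permL) big_cat /= !big_map.
Qed.

Lemma hook_prodE la : is_partition la ->
  hook_prod la = (\prod_(i < size la) \prod_(0 <= j < part la i) hook_length la i j)%N.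
Proof.
move=> laP; rewrite /hook_prod.
rewrite (@big_cell _ _ _ la (fun p => hook_length la p.1 p.2)).
rewrite -(pair_big_dep predT
  (fun (i : 'I_(size la)) (j : 'I_(head 0%N la)) => (j < part la i)%N)
  (fun i j => hook_length la i j)) /=.
apply: eq_bigr => i _; rewrite big_mkord.
by rewrite [RHS](big_ord_widen _ (hook_length la i) (part_le_head i laP)).
Qed.

(** Product of the row identities [hook_row_prod]; reversing the indices turns [n_j] into
    [part la k + (size la - 1 - k)]. *)
Lemma hook_prod_vdm la : is_partition la ->
  (hook_prod la * vdm_index la = \prod_(j < size la) (wr_index la j)`!)%N.
Proof.
move=> laP; rewrite hook_prodE // /vdm_index.
rewrite (exchange_big_dep xpredT) //= [X in (_ * X)%N](reindex_inj rev_ord_inj) /=.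
rewrite [RHS](reindex_inj rev_ord_inj) -big_split /=; apply: eq_bigr => i _.
have wrE (k : nat) : (k < size la)%N ->
    wr_index la (size la - k.+1) = (part la k + (size la - 1 - k))%N.
  by move=> lt; rewrite /wr_index; congr (part la _ + _)%N; lia.
rewrite wrE // -hook_row_prod //; congr (_ * _)%N.
rewrite (reindex_inj rev_ord_inj) /= big_geq_mkord; apply: eq_big => [k|k _].
  by have := ltn_ord i; have := ltn_ord k; lia.
by rewrite wrE.
Qed.

(** * Standard tableaux *)

Lemma card_cell la : is_partition la -> #|{: cell la}| = psize la.
Proof.
move=> laP; rewrite -sum1_card (@big_cell _ _ _ la (fun=> 1%N)).
rewrite -(pair_big_dep predT
  (fun (i : 'I_(size la)) (j : 'I_(head 0%N la)) => (j < part la i)%N)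
  (fun _ _ => 1%N)) /=.
rewrite /psize sumnE (big_nth 0%N) big_mkord; apply: eq_bigr => i _.
rewrite -(big_ord_widen _ (fun=> 1%N) (part_le_head i laP)) /=.
by rewrite sum1_card card_ord.
Qed.

Lemma is_sytE la (T : {ffun cell la -> 'I_(psize la)}) :
  is_syt T = is_ssyt T && injectiveb T.
Proof.
rewrite /is_syt /is_ssyt andbC; case: (injectiveP T) => [injT|]; rewrite ?andbF ?andbT //.
apply: eq_forallb => c; apply: eq_forallb => d; congr (_ && _).
case: eqP => //= E; case: ltnP => //= lt.
rewrite ltn_neqAle (_ : (T c != T d :> nat)) //.
by apply: contraTneq lt => /val_inj/injT ->; rewrite ltnn.
Qed.

(** The exponent of variable [i] counts the cells with entry [i]. There are as many cells as values,
    so an injective filling uses every value exactly once. *)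
Lemma content_injective la (T : {ffun cell la -> 'I_(psize la)}) :
  is_partition la ->
  ((\sum_(c : cell la) U_(T c))%MM == mesym1 setT) = injectiveb T.
Proof.
move=> laP.
have valE i : (\sum_(c : cell la) U_(T c))%MM i = #|[pred c | T c == i]|.
  rewrite mnm_sumE -sum1_card [RHS]big_mkcond /=; apply: eq_bigr => c _.
  by rewrite mnm1E inE; case: eqP.
apply/eqP/injectiveP => [E c d Tcd|injT].
  apply/eqP; have := valE (T c); rewrite E mnmE inE => /esym/eqP.
  move=> /card1P[e He].
  have : c \in [pred c' | T c' == T c] by rewrite inE.
  have : d \in [pred c' | T c' == T c] by rewrite inE Tcd.
  by rewrite !He !inE => /eqP-> /eqP->.
apply/mnmP => i; rewrite valE mnmE inE.
have : i \in codom T by apply: (inj_card_onto injT); rewrite card_ord card_cell.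
move=> /codomP[c ->]; apply/eqP/card1P; exists c => d.
by rewrite !inE (inj_eq injT).
Qed.

Lemma mcoeff_schur (R : comNzRingType) la : is_partition la ->
  (schur R (psize la) la)@_(mesym1 setT) = (num_syt la)%:R.
Proof.
move=> laP; rewrite /schur raddf_sum /= /num_syt -sum1_card natr_sum.
rewrite big_mkcond [RHS]big_mkcond /=; apply: eq_bigr => T _.
rewrite inE is_sytE; case: (is_ssyt T) => //=.
rewrite -content_injective // mprodXE mcoeffX.
by case: eqP.
Qed.

(** Divisors of a squarefree monomial are squarefree, so [h_n] may be replaced by [e_n], whose
    monomials are the sets [B]. *)
Lemma mcoeff_hsymM (R : comNzRingType) N n (p : {mpoly R[N]}) (A : {set 'I_N}) :
  (hsym R N n * p)@_(mesym1 A) =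
  \sum_(B in [set B : {set 'I_N} | B \subset A & #|B| == n]) p@_(mesym1 (A :\: B)).
Proof.
transitivity ((mesym N R n * p)@_(mesym1 A)).
  rewrite !mcoeffM; apply: eq_bigr => -[k1 k2] /= /eqP E.
  rewrite mcoeff_hsym mcoeff_mesym /mechar (_ : [forall i, _] = true) ?andbT //.
  apply/forallP => i; have /mnmP/(_ i) := E; rewrite mnmE mnmDE.
  by case: (i \in A) => /=; lia.
rewrite mesymE big_distrl raddf_sum /= big_mkcond [RHS]big_mkcond /=.
apply: eq_bigr => B _; rewrite mcoeffXM mesym1_le inE.
have -> : [set i | mesym1 A i != 0%N] = A.
  by apply/setP => i; rewrite inE mnmE; case: (i \in A).
rewrite andbC; case: ifP => //= _; case: ifP => // /subsetP sub; congr (_@_ _).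
apply/mnmP => i; rewrite mnmBE !mnmE inE.
by have := sub i; case: (i \in B) => [->|] //; rewrite subn0.
Qed.

(** The coefficient is a multinomial one: the first factor picks a block of [n] elements of [A], and
    the induction continues on the rest. *)
Lemma mcoeff_prod_hsym (R : comNzRingType) N (s : seq nat) (A : {set 'I_N}) :
  sumn s = #|A| ->
  (\prod_(n <- s) n`!)%:R * (\prod_(n <- s) hsym R N n)@_(mesym1 A) = #|A|`!%:R.
Proof.
elim: s A => [|n s IHs] A /= sA.
  rewrite !big_nil mul1r -sA; have -> : A = set0 by apply/eqP; rewrite -cards_eq0 -sA.
  by rewrite mesym1_set0 mcoeff1 eqxx.
rewrite !big_cons mcoeff_hsymM big_distrr /=.
rewrite (eq_bigr (fun=> (n`! * (#|A| - n)`!)%:R)); last first.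
  move=> B; rewrite inE => /andP[sub /eqP cB].
  have cD : #|A :\: B| = (#|A| - n)%N by rewrite cardsD (setIidPr sub) cB.
  by rewrite natrM -mulrA IHs ?cD ?natrM // -sA addKn.
rewrite sumr_const cards_draws -mulrnA mulnC bin_fact //.
by rewrite -sA leq_addr.
Qed.

Lemma num_syt_jacobi_trudi (R : fieldType) la :
  (forall n, n.+1%:R != 0 :> R) -> is_partition la ->
  (num_syt la)%:R = (psize la)`!%:R *
    jacobi_trudi (fun n => n`!%:R^-1) (fun i : 'I_(size la) => part la i) :> R.
Proof.
move=> char0 laP; have factN0 n : n`!%:R != 0 :> R by case: n`! (fact_gt0 n).
rewrite -mcoeff_schur // schur_jacobi_trudi // /jacobi_trudi /determinant.
rewrite raddf_sum big_distrr; apply: eq_bigr => s _ /=.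
rewrite mcoeff_signM mulrCA; congr (_ * _).
(* A permutation that meets a negative index contributes 0 to both determinants. *)
have [/forallP le|] := boolP [forall i : 'I_(size la), (i <= part la i + s i)%N]; last first.
  rewrite negb_forall => /existsP[i]; rewrite -ltnNge => lt.
  rewrite (bigD1 i) //= [in RHS](bigD1 i) //= !mxE !shifted_lt //.
  by rewrite !mul0r mcoeff0 mulr0.
pose a := [seq (part la i + s i - i)%N | i : 'I_(size la)].
have prodE (S : comPzRingType) (v : nat -> S) :
    \prod_i (\matrix_(i < size la, j < size la) shifted v (part la i + j) i) i (s i) =
    \prod_(n <- a) v n.
  rewrite big_image; apply: eq_bigr => i _.
  by rewrite mxE /shifted le.
rewrite !prodE prodfV -natr_prod.
(* The numbers [s i] and [i] have the same sum, so the indices add up to the size of [la]. *)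
have suma : sumn a = #|[set: 'I_(psize la)]|.
  rewrite cardsT card_ord sumnE big_image /=.
  apply/eqP; rewrite -(eqn_add2r (\sum_(i < size la) i)) -big_split /=.
  under eq_bigr => i _ do rewrite subnK ?le //.
  rewrite big_split /= /psize sumnE (big_nth 0%N) big_mkord eqn_add2l.
  by rewrite [X in _ == X](reindex_inj (@perm_inj _ s)).
have := mcoeff_prod_hsym R suma; rewrite cardsT card_ord => <-.
rewrite mulrC mulKf //.
by apply/eqP => /eqP; rewrite natr_prod prodf_seq_eq0 => /hasP[n _]; rewrite (negbTE (factN0 n)).
Qed.

(** * Evaluation at an Appell sequence *)

(** The largest index is at most the first part plus [size la - 1], and the other parts are
    positive, so no index exceeds the size of [la]. *)
Lemma eq_jacobi_trudi (S : comPzRingType) (u v : nat -> S) la :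
  is_partition la -> (forall n, (n <= psize la)%N -> u n = v n) ->
  jacobi_trudi u (fun i : 'I_(size la) => part la i) =
  jacobi_trudi v (fun i : 'I_(size la) => part la i).
Proof.
move=> laP uv; congr (\det _); apply/matrixP => i j; rewrite !mxE /shifted.
case: leqP => // le; apply: uv.
apply: (@leq_trans (head 0 la + (size la).-1)%N).
  have := part_le_head i laP; have := ltn_ord j; lia.
have /andP[_] := laP; case: la {laP i j le} => //= x s /andP[_ pos].
rewrite /psize /= leq_add2l; elim: s pos => //= y s IHs /andP[y_gt0 /IHs].
by move=> le_s; rewrite -add1n leq_add.
Qed.

Lemma rmorph_jacobi_trudi (S S' : comPzRingType) (f : {rmorphism S -> S'})
    (v : nat -> S) r (la : 'I_r -> nat) :
  f (jacobi_trudi v la) = jacobi_trudi (f \o v) la.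
Proof.
rewrite /jacobi_trudi -det_map_mx; congr (\det _); apply/matrixP => i j.
by rewrite !mxE /shifted; case: ifP; rewrite ?rmorph0.
Qed.

(** Exhibits the polynomial [Q] with [Q(h_1, ..., h_N) = s_la]. *)
Lemma comp_jacobi_trudi_xseq (R : comNzRingType) la : is_partition la ->
  jacobi_trudi (xseq R (psize la)) (fun i : 'I_(size la) => part la i)
    \mPo htuple R (psize la) = schur R (psize la) la.
Proof.
move=> laP; rewrite schur_jacobi_trudi //.
rewrite (rmorph_jacobi_trudi (comp_mpoly (htuple R (psize la)))).
apply: eq_jacobi_trudi => // n le_n; rewrite /= comp_xseq //.
by case: n {le_n} => //=; rewrite hsym0.
Qed.

Lemma phiA_jacobi_trudi_xseq (R : fieldType) (A : nat -> {poly R}) la :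
  appell A -> is_partition la ->
  phiA_poly A (jacobi_trudi (xseq R (psize la)) (fun i : 'I_(size la) => part la i)) =
  jacobi_trudi (fun n => n`!%:R^-1 *: A n) (fun i : 'I_(size la) => part la i).
Proof.
move=> [A0 _] laP; rewrite /phiA_poly rmorph_jacobi_trudi.
apply: eq_jacobi_trudi => // -[|n] le_n /=; first by rewrite rmorph1 A0 invr1 scale1r.
by rewrite (xvarE R (Ordinal le_n)) mmapX mmap1U.
Qed.

(* phi_A(s_lambda) is computed by writing s_lambda = Q(h_1,...,h_N) in
   N = |lambda| variables (such Q exists and is unique) and evaluating
   Q(A_1/1!, ..., A_N/N!). *)
Theorem theorem4p1 (R : realType) (A : nat -> {poly R}) (la : seq nat) :
  appell A -> is_partition la ->
  (exists Q : {mpoly R[psize la]},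
      comp_mpoly (htuple R (psize la)) Q = schur R (psize la) la) /\
  (forall Q : {mpoly R[psize la]},
      comp_mpoly (htuple R (psize la)) Q = schur R (psize la) la ->
      phiA_poly A Q = (hook_prod la)%:R^-1 *: wronskian_appell A la /\
      phiA_poly A Q = ((psize la)`!)%:R^-1 *: ((num_syt la)%:R *: wronskian_appell A la)).
Proof.
move=> appA laP; split.
  by exists (jacobi_trudi (xseq R (psize la)) (fun i : 'I_(size la) => part la i));
    apply: comp_jacobi_trudi_xseq.
move=> Q QE.
(* Independence of the [h]'s leaves only one possible [Q]. *)
have -> : Q = jacobi_trudi (xseq R (psize la)) (fun i : 'I_(size la) => part la i).
  apply/eqP; rewrite -subr_eq0; apply/eqP/hsym_independent.
  by rewrite comp_mpolyB QE comp_jacobi_trudi_xseq ?subrr.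
rewrite phiA_jacobi_trudi_xseq //.
have char0 n : n.+1%:R != 0 :> R by rewrite pnatr_eq0.
have nz n : (0 < n)%N -> n%:R != 0 :> R by rewrite pnatr_eq0 lt0n.
have factsN0 : (\prod_(j < size la) (wr_index la j)`!)%:R != 0 :> R.
  by apply/nz/prodn_gt0 => j; apply: fact_gt0.
have := factsN0; rewrite -(hook_prod_vdm laP) natrM mulf_eq0 negb_or => /andP[hookN0 vdmN0].
have hookE : (hook_prod la)%:R^-1 * (vdm_index la)%:R^-1 *
    (\prod_(j < size la) (wr_index la j)`!)%:R = 1 :> R.
  by rewrite -(hook_prod_vdm laP) natrM -invfM mulVf // mulf_neq0.
(* The hook length formula, which makes the two claimed values equal. *)
have sytE : (psize la)`!%:R^-1 * (num_syt la)%:R = (hook_prod la)%:R^-1 :> R.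
  rewrite num_syt_jacobi_trudi // mulKf ?nz ?fact_gt0 //.
  apply: (mulfI factsN0); rewrite -vdm_indexE // -(hook_prod_vdm laP) natrM.
  by rewrite mulrAC mulfV // mul1r.
rewrite [_`!%:R^-1 *: _]scalerA sytE.
by rewrite /wronskian_appell wronskianE // !scalerA hookE scale1r.
Qed.
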